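(* Let $d\ge1$ and let $\mathbf c$ be any nonzero vector in $\mathbb R^d$. Let $(\mathbf X_t)_{t\ge0}$ be a stationary random walk Metropolis--Hastings (RWMH) chain on $\mathbb R^d$ with target density $\pi$ and proposal step-density $\phi$ (both with respect to Lebesgue measure). If $\mathbf X_0\in L^2$, then $$\operatorname{Cov}(\langle\mathbf c,\mathbf X_0\rangle,\langle\mathbf c,\mathbf X_1\rangle)>0.$$
   Context: RWMH chain: $\pi$ and $\phi$ are probability densities on $\mathbb R^d$ with respect to Lebesgue measure, with no further conditions. Set $q(\mathbf x,\mathbf y)=\phi(\mathbf y-\mathbf x)$ and $$\alpha(\mathbf x,\mathbf y)=\begin{cases}\min\{1,\ \pi(\mathbf y)q(\mathbf y,\mathbf x)/(\pi(\mathbf x)q(\mathbf x,\mathbf y))\},&\pi(\mathbf x)q(\mathbf x,\mathbf y)>0,\\ 1,&\pi(\mathbf x)q(\mathbf x,\mathbf y)=0.\end{cases}$$ From state $\mathbf x$, the Markov chain proposes $\mathbf y$ drawn from the density $q(\mathbf x,\cdot)$, moves to $\mathbf y$ with probability $\alpha(\mathbf x,\mathbf y)$, and otherwise stays at $\mathbf x$. The chain is stationary: $\mathbf X_0$ (hence every $\mathbf X_t$) has density $\pi$. No irreducibility is assumed. $\langle\cdot,\cdot\rangle$ and $\|\cdot\|$ are the Euclidean inner product and norm, and $\mathbf X_0\in L^2$ means $\mathbb E\|\mathbf X_0\|^2<\infty$. *)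

(* Defs.v *)
From HB Require Import structures.
From mathcomp Require Import all_boot all_order all_algebra.
From mathcomp Require Import all_classical all_reals all_analysis.
Import Order.TTheory GRing.Theory Num.Theory.

Set Implicit Arguments.
Unset Strict Implicit.
Unset Printing Implicit Defensive.

Local Open Scope classical_set_scope.
Local Open Scope ring_scope.

(* R^d is [d.-tuple R]: MathComp-Analysis equips it with the product of the
   Borel sigma-algebras of the coordinates, i.e. the Borel sets of R^d. *)

Section euclidean.
Context {R : realType} {d : nat}.
Implicit Types x y : d.-tuple R.

Definition vsub y x : d.-tuple R := [tuple tnth y i - tnth x i | i < d].
Definition inner x y : R := \sum_(i < d) tnth x i * tnth y i.
Definition enorm x : R := Num.sqrt (inner x x).

End euclidean.

Section lebesgue_step.
Context {R : realType} (n : nat).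

Notation RB := (measurableTypeR R).

Definition cons_pair (z : RB * n.-tuple R) : n.+1.-tuple R :=
  [tuple of (z.1 : R) :: z.2].

Let measurable_cons_pair : measurable_fun setT cons_pair.
Proof.
exact: (@measurable_cons _ _ (RB * n.-tuple R)%type R fst _ snd).
Qed.

Variable m : {sigma_finite_measure set (n.-tuple R) -> \bar R}.

Definition lebesgue_step : set (n.+1.-tuple R) -> \bar R :=
  pushforward (@lebesgue_measure R \x m)%E cons_pair.

Let lebesgue_step0 : lebesgue_step set0 = 0%E.
Proof. by rewrite /lebesgue_step /pushforward preimage_set0 measure0. Qed.

Let lebesgue_step_ge0 A : (0 <= lebesgue_step A)%E.
Proof. exact: measure_ge0. Qed.

Let lebesgue_step_sigma_additive : semi_sigma_additive lebesgue_step.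
Proof. exact: measure_semi_sigma_additive. Qed.

HB.instance Definition _ := isMeasure.Build _ _ _ lebesgue_step
  lebesgue_step0 lebesgue_step_ge0 lebesgue_step_sigma_additive.

Let uncons (x : n.+1.-tuple R) : RB * n.-tuple R :=
  (thead x, [tuple of behead x]).

Let cons_pairK : cancel cons_pair uncons.
Proof. by case=> a t; congr pair; exact: val_inj. Qed.

Let measurable_uncons : measurable_fun setT uncons.
Proof.
apply: measurable_fun_pair; last exact: measurable_behead.
by move=> _ A mA; exact: (@measurable_tnth _ R).
Qed.

Let lebesgue_step_sigma_finite : sigma_finite setT lebesgue_step.
Proof.
have /sigma_finiteP[F [TF ndF Foo]] := sigma_finiteT (@lebesgue_measure R).
have /sigma_finiteP[G [TG ndG Goo]] := sigma_finiteT m.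
exists (fun k => uncons @^-1` (F k `*` G k)).
  rewrite -preimage_bigcup -[LHS](preimage_setT uncons); congr (_ @^-1` _).
  rewrite -setXTT TF TG; apply/seteqP; split => -[x y].
    move=> [/= [i _ Fx] [j _ Gy]]; exists (maxn i j) => //; split.
      by move: x Fx; exact/subsetPset/ndF/leq_maxl.
    by move: y Gy; exact/subsetPset/ndG/leq_maxr.
  by move=> [i _ [/= Fx Gy]]; split; exists i.
move=> k; have [mF Fk] := Foo k; have [mG Gk] := Goo k; split.
  rewrite -[X in measurable X]setTI; apply: measurable_uncons => //.
  exact: measurableX.
have -> : lebesgue_step (uncons @^-1` (F k `*` G k)) =
    (@lebesgue_measure R \x m)%E (F k `*` G k).
  rewrite /lebesgue_step /pushforward -comp_preimage.
  by rewrite (_ : uncons \o cons_pair = id)//; exact/funext/cons_pairK.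
by rewrite product_measure1E// lte_mul_pinfty// ge0_fin_numE.
Qed.

HB.instance Definition _ :=
  Measure_isSigmaFinite.Build _ _ _ lebesgue_step lebesgue_step_sigma_finite.

End lebesgue_step.

Fixpoint lebesgueRd (R : realType) (d : nat) :
    {sigma_finite_measure set (d.-tuple R) -> \bar R} :=
  match d with
  | 0 => dirac [tuple]
  | n.+1 => lebesgue_step (lebesgueRd R n)
  end.

Arguments lebesgueRd {R d}.

Lemma lebesgueRd_box (R : realType) (d : nat) (A : 'I_d -> set R) :
  (forall i, measurable (A i)) ->
  lebesgueRd [set x : d.-tuple R | forall i, A i (tnth x i)] =
  (\prod_(i < d) lebesgue_measure (A i))%E.
Proof.
elim: d A => [|d IH] A mA.
  by rewrite big_ord0 /= diracE mem_set//= => -[].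
have mA0 : measurable (A ord0 : set (measurableTypeR R)) := mA ord0.
have mB : measurable [set x : d.-tuple R | forall i, A (lift ord0 i) (tnth x i)].
  rewrite (_ : mkset _ = \bigcap_i
      ((fun x : d.-tuple R => tnth x i) @^-1` A (lift ord0 i))); last first.
    by apply/seteqP; split => x /= H i; [move=> _|]; exact: H.
  apply: fin_bigcap_measurable => // i _.
  have := @measurable_tnth _ R d i measurableT _ (mA (lift ord0 i)).
  by rewrite setTI.
rewrite big_ord_recl -IH// -product_measure1E//=.
rewrite /lebesgue_step /pushforward.
apply: (congr1 (product_measure1 _ _)).
apply/seteqP; split => -[a t] /=.
  move=> H; split; first by have := H ord0; rewrite tnth0.
  by move=> i; have := H (lift ord0 i); rewrite tnthS.
by move=> [Ha Ht] i; have [j ->|->] := unliftP ord0 i; rewrite ?tnth0 ?tnthS.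
Qed.

Section rwmh.
Context {R : realType} {d : nat}.
Implicit Types (pi phi : d.-tuple R -> R) (x y : d.-tuple R).

Definition is_density (f : d.-tuple R -> R) : Prop :=
  [/\ measurable_fun setT f, forall x, 0 <= f x &
      (\int[lebesgueRd]_x (f x)%:E = 1)%E].

Definition proposal phi x y : R := phi (vsub y x).

Definition acceptance pi phi x y : R :=
  if 0 < pi x * proposal phi x y then
    Num.min 1 (pi y * proposal phi y x / (pi x * proposal phi x y))
  else 1.

(* One-step law from [x]: the proposal [y] is accepted (the chain moves to
   [y]) with probability [acceptance pi phi x y] and otherwise rejected (the
   chain stays at [x]). *)
Definition rwmh_kernel pi phi x (B : set (d.-tuple R)) : \bar R :=
  (\int[lebesgueRd]_y
    (proposal phi x y * (acceptance pi phi x y * \1_B y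
                         + (1 - acceptance pi phi x y) * \1_B x))%:E)%E.

End rwmh.

Section markov_chain.
Local Open Scope ereal_scope.
Context {dO dT : measure_display} {Omega : measurableType dO}
  {T : measurableType dT} {R : realType} (P : probability Omega R).

(* P(X_(n+1) \in B | X_0, ..., X_n) = K(X_n, B) almost surely, written out
   through the defining property of conditional probability: [F] ranges over
   the sigma-algebra generated by X_0, ..., X_n. *)
Definition markov_chain (K : T -> set T -> \bar R) (X : nat -> {RV P >-> T}) :
    Prop :=
  forall (n : nat) (F : set Omega) (B : set T),
    g_sigma_preimage (fun i : 'I_n.+1 => X i : Omega -> T) F -> measurable B ->
    P (F `&` X n.+1 @^-1` B) = \int[P]_(w in F) K (X n w) B.

End markov_chain.

Section stationary_rwmh.
Context {dO : measure_display} {Omega : measurableType dO} {R : realType}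
  {d : nat} (P : probability Omega R).

Definition has_density (Y : {RV P >-> d.-tuple R}) (f : d.-tuple R -> R) :
    Prop :=
  forall B, measurable B ->
    distribution P Y B = (\int[lebesgueRd]_(x in B) (f x)%:E)%E.

(* Stationarity is the requirement that the initial state has density [pi]:
   by detailed balance [pi] is invariant under [rwmh_kernel pi phi], so every
   state then has density [pi]. *)
Definition stationary_rwmh (pi phi : d.-tuple R -> R)
    (X : nat -> {RV P >-> d.-tuple R}) : Prop :=
  markov_chain (rwmh_kernel pi phi) X /\ has_density (X 0%N) pi.

End stationary_rwmh.

(* Main.v *)
From HB Require Import structures.
Require Import Defs.
From mathcomp Require Import all_boot all_order all_algebra.
From mathcomp Require Import all_classical all_reals all_analysis.
From mathcomp Require Import measurable_realfun ring lra.

(** Write [f x = <c, x>], let [mu] be the mean of [f] under [pi], put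
    [g = f - mu], and let [V] be the integral of [g ^ 2 pi].  Stationarity
    gives [E g(X_0)^2 = E g(X_1)^2 = V] and hence
    [2 Cov(f(X_0), f(X_1)) = 2 V - E (f(X_1) - f(X_0))^2], so the theorem says
    that the mean squared increment is strictly below [2 V].

    An accepted move from [x] to [y] has density
    [m(x, y) = min(pi(x) phi(y - x), pi(y) phi(x - y))], which is symmetric, and a
    rejected proposal does not contribute to the increment.  By symmetry it
    therefore suffices to show that
    [m(x, y) (f(y) - f(x))^2], integrated over the pairs with [f(x) < f(y)], is
    strictly below [V].

    Fix such a pair, put [u = g(x) < v = g(y)], [p = phi(y - x)],
    [q = phi(x - y)], and assign to [x] the cost [pi(x) u^2] only if [u <= 0],
    and to [y] the cost [pi(y) v^2] only if [v > 0].  If [u <= 0 < v], then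
    Cauchy-Schwarz, [(v - u)^2 <= (p + q) (u^2 / p + v^2 / q)], together with
    [m <= pi(x) p] and [m <= pi(y) q], bounds the integrand by [p + q] times the
    sum of the two costs.  If [u] and [v] lie on the same side of [0], then
    [v - u] is at most the larger of [|u|], [|v|] and the same bound holds with
    the one remaining cost ([min_flow_sqr_le]).  Since [x] and [y] are charged on
    complementary half-spaces, and since [phi(z) + phi(- z)] integrates to at most
    [1] over the half-space [<c, z> > 0], the bound integrates to at most [V]
    ([integral_majorant_le]).  Charging every point on one side only is what
    saves the factor [2] with respect to a naive use of [(v - u)^2].

    The bound is strict.  If the two integrals agreed, the pointwise bound would
    be an equality almost everywhere.  Equality with a nonzero right-hand side
    forces [u = 0], [v = 0] or [u q + v p = 0] with [p + q > 0]; for a fixed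
    increment [y - x] each of these confines [x] to a hyperplane orthogonal to
    [c], a null set ([hyperplane_null], [null_shear]).  So the right-hand side
    would vanish almost everywhere, giving [V = 0], which is impossible because
    [pi] is a density and [g = 0] is a null set ([energy_lt]).

    The link with the chain is the joint law of [(X_0, X_1)], obtained from the
    Markov property on measurable rectangles and extended to all nonnegative
    measurable functions ([ge0_integral_two_steps]). *)

Import Order.TTheory GRing.Theory Num.Theory.

Set Implicit Arguments.
Unset Strict Implicit.
Unset Printing Implicit Defensive.

Local Open Scope classical_set_scope.
Local Open Scope ring_scope.

(** * Lebesgue measure on R^d: Tonelli, invariance, hyperplanes *)

Section lebesgueRd_theory.
Context {R : realType}.
Local Open Scope ereal_scope.

Lemma measurable_inner d (c : d.-tuple R) : measurable_fun setT (inner c).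
Proof.
apply: measurable_sum => i; apply: measurable_funM => //.
exact: measurable_tnth.
Qed.

Lemma measurable_cons_pair n : measurable_fun setT (@cons_pair R n).
Proof.
exact: (@measurable_cons _ _ (measurableTypeR R * n.-tuple R)%type R fst _ snd).
Qed.

Lemma integral_lebesgueRdS1 n (F : n.+1.-tuple R -> \bar R) :
  measurable_fun setT F -> (forall x, 0 <= F x) ->
  \int[lebesgueRd]_x F x =
  \int[lebesgue_measure]_a \int[lebesgueRd]_t F (cons_pair (a, t)).
Proof.
move=> mF F0; rewrite /= /lebesgue_step.
rewrite (ge0_integral_pushforward (@measurable_cons_pair n))//=.
by rewrite fubini_tonelli1//; exact: measurableT_comp (@measurable_cons_pair n).
Qed.

Lemma integral_lebesgueRdS2 n (F : n.+1.-tuple R -> \bar R) :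
  measurable_fun setT F -> (forall x, 0 <= F x) ->
  \int[lebesgueRd]_x F x =
  \int[lebesgueRd]_t \int[lebesgue_measure]_a F (cons_pair (a, t)).
Proof.
move=> mF F0; rewrite /= /lebesgue_step.
rewrite (ge0_integral_pushforward (@measurable_cons_pair n))//=.
by rewrite fubini_tonelli2//; exact: measurableT_comp (@measurable_cons_pair n).
Qed.

(** Invariance is phrased on integrals of nonnegative functions, because this is
    the form that passes through the iterated integrals over the coordinates. *)
Definition integral_preserving (s : measurableTypeR R -> measurableTypeR R) :=
  measurable_fun setT s /\
  forall F : measurableTypeR R -> \bar R,
    measurable_fun setT F -> (forall a, 0 <= F a) ->
    \int[lebesgue_measure]_a F (s a) = \int[lebesgue_measure]_a F a.

Lemma integral_preserving_measure (s : measurableTypeR R -> measurableTypeR R) :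
  measurable_fun setT s ->
  (forall A, measurable A -> lebesgue_measure (s @^-1` A) = lebesgue_measure A) ->
  integral_preserving s.
Proof.
move=> ms sE; split=> // F mF F0.
have := @ge0_integral_pushforward _ _ _ _ _ _ ms lebesgue_measure setT F
  measurableT mF (fun x _ => F0 x).
rewrite preimage_setT => <-.
by apply: eq_measure_integral => A mA _; exact: sE.
Qed.

Lemma integral_preservingN : integral_preserving -%R.
Proof.
apply: integral_preserving_measure; first exact: oppr_measurable.
exact: lebesgue_measureN.
Qed.

Lemma integral_preservingD (t : R) : integral_preserving (fun a => t + a)%R.
Proof.
have mt : measurable_fun setT
    (fun a : measurableTypeR R => t + a : measurableTypeR R)%R.
  by apply: measurable_funD => //; exact: measurable_id.
apply: integral_preserving_measure => // A mA.
pose nu := pushforward lebesgue_measure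
  (fun a : measurableTypeR R => t + a : measurableTypeR R)%R.
apply/esym; apply: (@lebesgue_measure_unique _ nu) => //= _ [[a b]] _ <-.
rewrite /nu /pushforward /=.
rewrite (_ : _ @^-1` _ = `](a - t)%R, (b - t)%R]%classic); last first.
  by apply/seteqP; split => x /=; rewrite !in_itv /= ltrBlDl lerBrDl.
rewrite !lebesgue_measure_itv/= !lte_fin ltrD2r.
by case: ifP => // _; rewrite -!EFinD; congr _%:E; lra.
Qed.

Lemma measurable_tuple_map d (s : 'I_d -> measurableTypeR R -> measurableTypeR R) :
  (forall i, measurable_fun setT (s i)) ->
  measurable_fun setT (fun x : d.-tuple R => [tuple s i (tnth x i) | i < d]).
Proof.
move=> ms; apply/measurable_fun_tnthP => i.
rewrite (_ : _ \o _ = fun x : d.-tuple R => s i (tnth x i)); last first.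
  by apply/funext => x /=; rewrite tnth_mktuple.
by apply: (measurableT_comp (ms i)); exact: measurable_tnth.
Qed.

(** The coordinates are integrated one at a time, so a map acting on each
    coordinate by an integral preserving map preserves the whole integral.  It
    covers both translations and the reflection [z |-> - z]. *)
Lemma integral_lebesgueRd_map d
    (s : 'I_d -> measurableTypeR R -> measurableTypeR R)
    (F : d.-tuple R -> \bar R) :
  (forall i, integral_preserving (s i)) ->
  measurable_fun setT F -> (forall x, 0 <= F x) ->
  \int[lebesgueRd]_x F [tuple s i (tnth x i) | i < d] = \int[lebesgueRd]_x F x.
Proof.
elim: d s F => [|n IH] s F sP mF F0.
  by apply: eq_integral => x _; congr F; apply: eq_from_tnth => -[].
have mG : measurable_fun setT
    (fun x : n.+1.-tuple R => F [tuple s i (tnth x i) | i < n.+1]).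
  by apply: measurableT_comp mF _; apply: measurable_tuple_map => i; case: (sP i).
rewrite integral_lebesgueRdS1// [RHS]integral_lebesgueRdS1//.
have [m0 s0] := sP ord0.
have mFc : measurable_fun setT (fun z => F (cons_pair z)).
  exact: measurableT_comp (@measurable_cons_pair n).
rewrite -[RHS]s0//; last 2 first.
- by have := @measurable_fun_fubini_tonelli_F _ _ _ _ _ (@lebesgueRd R n) _ mFc
    (fun z => F0 _).
- by move=> a; apply: integral_ge0.
apply: eq_integral => a _.
rewrite -[RHS](IH (fun i => s (lift ord0 i)))//; last first.
  by apply: measurableT_comp mFc _; exact: pair1_measurable.
apply: eq_integral => t _; congr F; apply: eq_from_tnth => i.
by rewrite !tnth_mktuple; case: (unliftP ord0 i) => [j|] ->;
  rewrite ?tnth0 ?tnthS ?tnth_mktuple.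
Qed.

Definition vadd d (x z : d.-tuple R) : d.-tuple R :=
  [tuple tnth x i + tnth z i | i < d]%R.

Definition vopp d (z : d.-tuple R) : d.-tuple R := [tuple - tnth z i | i < d]%R.

Lemma integral_lebesgueRdD d (x : d.-tuple R) (F : d.-tuple R -> \bar R) :
  measurable_fun setT F -> (forall x, 0 <= F x) ->
  \int[lebesgueRd]_z F (vadd x z) = \int[lebesgueRd]_y F y.
Proof.
move=> mF F0; apply: (integral_lebesgueRd_map
  (s := fun i a => (tnth x i + a)%R)) => // i.
exact: integral_preservingD.
Qed.

Lemma integral_lebesgueRdN d (F : d.-tuple R -> \bar R) :
  measurable_fun setT F -> (forall x, 0 <= F x) ->
  \int[lebesgueRd]_z F (vopp z) = \int[lebesgueRd]_y F y.
Proof.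
move=> mF F0; apply: (integral_lebesgueRd_map (s := fun i => -%R)) => // i.
exact: integral_preservingN.
Qed.

Lemma vsub_vadd d (x z : d.-tuple R) : vsub (vadd x z) x = z.
Proof. by apply: eq_from_tnth => i; rewrite !tnth_mktuple; lra. Qed.

Lemma vopp_vsub d (x y : d.-tuple R) : vopp (vsub y x) = vsub x y.
Proof. by apply: eq_from_tnth => i; rewrite !tnth_mktuple; lra. Qed.

Lemma measurable_vsub d : measurable_fun setT
  (fun z : d.-tuple R * d.-tuple R => vsub z.2 z.1).
Proof.
apply/measurable_fun_tnthP => i.
rewrite (_ : _ \o _ = fun z : d.-tuple R * d.-tuple R =>
  (tnth z.2 i - tnth z.1 i)%R); last first.
  by apply/funext => x /=; rewrite tnth_mktuple.
by apply: measurable_funB; apply: (measurableT_comp (@measurable_tnth _ R d i)).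
Qed.

Lemma measurable_vadd d : measurable_fun setT
  (fun z : d.-tuple R * d.-tuple R => vadd z.1 z.2).
Proof.
apply/measurable_fun_tnthP => i.
rewrite (_ : _ \o _ = fun z : d.-tuple R * d.-tuple R =>
  (tnth z.1 i + tnth z.2 i)%R); last first.
  by apply/funext => x /=; rewrite tnth_mktuple.
by apply: measurable_funD; apply: (measurableT_comp (@measurable_tnth _ R d i)).
Qed.

Lemma measurable_vopp d : measurable_fun setT (@vopp d).
Proof.
by apply: (measurable_tuple_map (s := fun=> -%R)) => i; exact: oppr_measurable.
Qed.

Lemma integral_lebesgueRd_vsub d (x : d.-tuple R) (F : d.-tuple R -> \bar R) :
  measurable_fun setT F -> (forall x, 0 <= F x) ->
  \int[lebesgueRd]_y F (vsub y x) = \int[lebesgueRd]_z F z.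
Proof.
move=> mF F0; rewrite -(integral_lebesgueRdD x)//.
  by apply: eq_integral => z _; rewrite vsub_vadd.
apply: measurableT_comp mF _.
exact: (measurableT_comp (@measurable_vsub d) (pair1_measurable x)).
Qed.

Lemma integral_lebesgueRd_vsub_swap d (y : d.-tuple R) (F : d.-tuple R -> \bar R) :
  measurable_fun setT F -> (forall x, 0 <= F x) ->
  \int[lebesgueRd]_x F (vsub y x) = \int[lebesgueRd]_z F z.
Proof.
move=> mF F0; rewrite -[RHS]integral_lebesgueRdN// -[RHS](integral_lebesgueRd_vsub y)//.
  by apply: eq_integral => z _; rewrite vopp_vsub.
by apply: measurableT_comp mF _; exact: measurable_vopp.
Qed.

Lemma inner_cons_pair n (c : n.+1.-tuple R) (z : measurableTypeR R * n.-tuple R) :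
  inner c (cons_pair z) = (thead c * z.1 + inner [tuple of behead c] z.2)%R.
Proof.
rewrite /inner big_ord_recl tnth0; congr (_ + _)%R.
by apply: eq_bigr => i _; rewrite tnthS [in LHS](tuple_eta c) tnthS.
Qed.

Lemma eq_indic (T U : Type) (A : set T) (B : set U) x y :
  (A x <-> B y) -> \1_A x = \1_B y :> R.
Proof.
by move=> AB; rewrite !indicE; congr (nat_of_bool _)%:R; apply/idP/idP;
  rewrite !inE => /AB.
Qed.

Lemma measurable_hyperplane d (c : d.-tuple R) (k : R) :
  measurable [set x | inner c x = k].
Proof.
rewrite (_ : mkset _ = inner c @^-1` [set k])//.
by rewrite -[X in measurable X]setTI; exact: measurable_inner.
Qed.

(** Induction on the dimension: if the first coefficient vanishes, every section
    over the first coordinate is a hyperplane of smaller dimension; otherwise every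
    section over the remaining coordinates is a single point of the line. *)
Lemma hyperplane_null d (c : d.-tuple R) (k : R) :
  c <> [tuple 0%R | i < d] -> lebesgueRd [set x | inner c x = k] = 0.
Proof.
have mH := measurable_hyperplane.
elim: d c k => [|n IH] c k c0; first by case: c0; apply: eq_from_tnth => -[].
rewrite -[X in lebesgueRd X]setIT -integral_indic//; last exact: mH.
have m1 : measurable_fun setT
    (fun x : n.+1.-tuple R => (\1_[set x | inner c x = k] x)%:E : \bar R).
  by apply/measurable_EFinP; apply: measurable_indic; exact: mH.
have [hc0|hc0] := eqVneq (thead c) 0%R.
  rewrite integral_lebesgueRdS1// integral0_eq// => a _.
  rewrite (eq_integral (fun t : n.-tuple R =>
    (\1_[set t | inner [tuple of behead c] t = k] t)%:E : \bar R)); last first.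
    move=> t _; congr (_%:E); apply: eq_indic => /=.
    by rewrite inner_cons_pair hc0 mul0r add0r.
  rewrite integral_indic; [|exact: measurableT|exact: mH].
  rewrite setIT; apply: IH => c'0; apply: c0.
  apply: eq_from_tnth => i; rewrite tnth_mktuple.
  case: (unliftP ord0 i) => [j|] -> //.
  have -> : tnth c (lift ord0 j) = tnth [tuple of behead c] j.
    by rewrite [in LHS](tuple_eta c) tnthS.
  by rewrite c'0 tnth_mktuple.
rewrite integral_lebesgueRdS2// integral0_eq// => t _.
rewrite (eq_integral (fun a : measurableTypeR R =>
    (\1_[set (k - inner [tuple of behead c] t) / thead c]%R a)%:E : \bar R)).
  by rewrite integral_indic// setIT; exact: lebesgue_measure_set1.
move=> a _; congr (_%:E); apply: eq_indic => /=.
rewrite inner_cons_pair/=; split => [<-|->].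
  by rewrite addrK mulrC mulKf.
by rewrite mulrC divfK// subrK.
Qed.

End lebesgueRd_theory.

(** * The pointwise bound on the squared increment *)

Section pointwise.
Context {R : realType}.
Implicit Types a b p q u v : R.

(** Here [a], [b] stand for the densities at the two endpoints, [p], [q] for the
    step densities of the move and of its reverse, and [u], [v] for the centred
    values of the linear functional.  When [u <= 0 < v] and [m > 0], the right-hand
    side exceeds the left-hand side by
    [(p + q) (u^2 (a - m/p) + v^2 (b - m/q)) + m (u q + v p)^2 / (p q)],
    a sum of nonnegative terms; this gives the inequality and also shows that
    equality forces [u q + v p = 0]. *)
Lemma min_flow_sqr_le a b p q u v :
  0 <= a -> 0 <= b -> 0 <= p -> 0 <= q -> u < v ->
  let m := Num.min (a * p) (b * q) in
  let r := (p + q) * ((if u <= 0 then u ^+ 2 * a else 0)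
                     + (if 0 < v then v ^+ 2 * b else 0)) in
  m * (v - u) ^+ 2 <= r /\
  (m * (v - u) ^+ 2 = r -> u <> 0 -> v <> 0 ->
   (p + q <> 0 -> u * q + v * p <> 0) -> r = 0).
Proof.
move=> a0 b0 p0 q0 uv m r.
have m0 : 0 <= m by rewrite le_min !mulr_ge0.
have ma : m <= a * p by rewrite ge_min lexx.
have mb : m <= b * q by rewrite ge_min lexx orbT.
(* The case where both values lie on the same side: the smaller gap [v' - u']
   is compared with [v'] alone. *)
have one_side b' p' q' u' v' : 0 <= b' -> 0 <= p' -> 0 <= q' -> 0 <= u' ->
    u' < v' -> m <= b' * q' ->
    m * (v' - u') ^+ 2 <= (p' + q') * (v' ^+ 2 * b') /\
    (m * (v' - u') ^+ 2 = (p' + q') * (v' ^+ 2 * b') -> u' <> 0 ->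
      (p' + q') * (v' ^+ 2 * b') = 0).
  move=> b'0 p'0 q'0 u'0 uv' mb'.
  have v'0 : 0 < v' by apply: le_lt_trans uv'.
  have h1 : m * (v' - u') ^+ 2 <= b' * q' * (v' - u') ^+ 2.
    by rewrite ler_wpM2r// sqr_ge0.
  have h2 : b' * q' * (v' - u') ^+ 2 <= b' * q' * v' ^+ 2.
    by rewrite ler_wpM2l ?mulr_ge0// ler_sqr ?nnegrE; lra.
  have h3 : 0 <= p' * (v' ^+ 2 * b').
    by apply: mulr_ge0 => //; apply: mulr_ge0 => //; exact: sqr_ge0.
  split; first nra.
  move=> eqm u'n0.
  have u'p : 0 < u' by rewrite lt_neqAle u'0 andbT eq_sym; exact/eqP.
  have h4 : p' * (v' ^+ 2 * b') = 0 by nra.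
  have h5 : b' * q' * (v' ^+ 2 - (v' - u') ^+ 2) = 0 by nra.
  have : v' ^+ 2 - (v' - u') ^+ 2 != 0 by rewrite gt_eqF//; nra.
  move/eqP: h5; rewrite mulf_eq0 => /orP[/eqP h5 _|->//].
  by rewrite mulrDl h4 add0r mulrCA (mulrC q') h5 mulr0.
rewrite /r; case: (leP u 0) => u0; case: (ltP 0 v) => v0.
- have [m00|m00] := eqVneq m 0.
    rewrite m00 mul0r; split; last by move=> <-.
    by apply: mulr_ge0; apply: addr_ge0 => //; apply: mulr_ge0 => //; exact: sqr_ge0.
  have mp : 0 < m by rewrite lt_neqAle eq_sym m00.
  have pp : 0 < p.
    rewrite lt_neqAle p0 andbT; apply: contraTneq ma => <-.
    by rewrite mulr0 -ltNge.
  have qp : 0 < q.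
    rewrite lt_neqAle q0 andbT; apply: contraTneq mb => <-.
    by rewrite mulr0 -ltNge.
  have mpa : 0 <= a - m / p by rewrite subr_ge0 ler_pdivrMr.
  have mqb : 0 <= b - m / q by rewrite subr_ge0 ler_pdivrMr.
  have key : (p + q) * (u ^+ 2 * a + v ^+ 2 * b) - m * (v - u) ^+ 2 =
      (p + q) * (u ^+ 2 * (a - m / p) + v ^+ 2 * (b - m / q)) +
      m * (u * q + v * p) ^+ 2 / (p * q).
    by field; rewrite !gt_eqF.
  have k1 : 0 <= (p + q) * (u ^+ 2 * (a - m / p) + v ^+ 2 * (b - m / q)).
    by apply: mulr_ge0; apply: addr_ge0 => //; apply: mulr_ge0 => //; exact: sqr_ge0.
  have k2 : 0 <= m * (u * q + v * p) ^+ 2 / (p * q).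
    by apply: divr_ge0; apply: mulr_ge0 => //; exact: sqr_ge0.
  split; first lra.
  move=> eqm _ _ h; exfalso; apply: h; first by apply/eqP; rewrite gt_eqF//; lra.
  have : m * (u * q + v * p) ^+ 2 / (p * q) = 0 by lra.
  have mpq : m / (p * q) != 0 by rewrite gt_eqF// divr_gt0// mulr_gt0.
  by move/eqP; rewrite mulrAC mulf_eq0 (negbTE mpq) sqrf_eq0 => /eqP.
(* The reflection [x |-> - x] exchanges the endpoints. *)
- rewrite addr0.
  have nv0 : 0 <= - v by rewrite oppr_ge0.
  have nuv : - v < - u by rewrite ltrN2.
  have [h1 h2] := one_side a q p (- v) (- u) a0 q0 p0 nv0 nuv ma.
  have -> : v - u = - u - - v by lra.
  have -> : (p + q) * (u ^+ 2 * a) = (q + p) * ((- u) ^+ 2 * a) by ring.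
  by split => // eqm _ vn0 _; apply: h2 => //; lra.
- rewrite add0r.
  have [h1 h2] := one_side b p q u v b0 p0 q0 (ltW u0) uv mb.
  by split => // eqm un0 _ _; exact: h2.
- by exfalso; lra.
Qed.
End pointwise.

(** * Integrals and null sets on pairs of points *)

Section ae_tools.
Context {d : measure_display} {T : measurableType d} {R : realType}.
Variable mu : {measure set T -> \bar R}.
Local Open Scope ereal_scope.

Lemma ge0_le_integral_ae_eq (l r : T -> \bar R) :
  measurable_fun setT l -> measurable_fun setT r ->
  (forall x, 0 <= l x) -> (forall x, l x \is a fin_num) ->
  (forall x, l x <= r x) ->
  \int[mu]_x r x <= \int[mu]_x l x -> \int[mu]_x r x < +oo ->
  {ae mu, forall x, l x = r x}.
Proof.
move=> ml mr l0 lfin lr rl roo.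
have d0 x : 0 <= r x - l x by rewrite sube_ge0// lfin.
have md : measurable_fun setT (fun x => r x - l x) by exact: emeasurable_funB.
have rE : \int[mu]_x r x = \int[mu]_x l x + \int[mu]_x (r x - l x).
  rewrite -ge0_integralD//; apply: eq_integral => x _.
  by rewrite addeC subeK.
have lfinI : \int[mu]_x l x \is a fin_num.
  rewrite ge0_fin_numE ?integral_ge0//; apply: le_lt_trans roo.
  exact: ge0_le_integral.
have dint : \int[mu]_x `|r x - l x| = 0.
  under eq_integral do rewrite gee0_abs//.
  apply/eqP; rewrite eq_le integral_ge0// andbT.
  by move: rl; rewrite rE -[leRHS]adde0 leeD2lE.
have /(ae_eq_integral_abs mu measurableT md) := dint.
apply: filterS => x /(_ I) /= h.
by rewrite -[RHS](subeK _ (lfin x)) h add0e.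
Qed.

Lemma ae_notin (N : set T) : measurable N -> mu N = 0 ->
  {ae mu, forall x, ~ N x}.
Proof. by move=> mN N0; exists N; split => // x /= /contrapT. Qed.

End ae_tools.

Section integral_on_pairs.
Context {R : realType} {d : nat}.
Local Notation T := (d.-tuple R).
Local Notation lambda := (@lebesgueRd R d).
Local Open Scope ereal_scope.

Lemma integral_convolution (psi A B : T -> R) :
  measurable_fun setT psi -> measurable_fun setT A -> measurable_fun setT B ->
  (forall z, 0 <= psi z)%R -> (forall z, 0 <= A z)%R -> (forall z, 0 <= B z)%R ->
  \int[lambda \x lambda]_z (psi (vsub z.2 z.1) * (A z.1 + B z.2))%:E =
  \int[lambda]_z (psi z)%:E * (\int[lambda]_x (A x)%:E + \int[lambda]_y (B y)%:E).
Proof.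
move=> mpsi mA mB psi0 A0 B0.
have mpsi2 : measurable_fun setT (fun z : T * T => psi (vsub z.2 z.1)).
  exact: measurableT_comp mpsi (@measurable_vsub R d).
have mA2 : measurable_fun setT (fun z : T * T => A z.1).
  exact: measurableT_comp mA measurable_fst.
have mB2 : measurable_fun setT (fun z : T * T => B z.2).
  exact: measurableT_comp mB measurable_snd.
have mpA : measurable_fun setT
    (fun z : T * T => (psi (vsub z.2 z.1) * A z.1)%:E).
  by apply/measurable_EFinP; exact: measurable_funM.
have mpB : measurable_fun setT
    (fun z : T * T => (psi (vsub z.2 z.1) * B z.2)%:E).
  by apply/measurable_EFinP; exact: measurable_funM.
have mpsiE : measurable_fun setT (fun z => (psi z)%:E) by exact/measurable_EFinP.
have mAE : measurable_fun setT (fun z => (A z)%:E) by exact/measurable_EFinP.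
have mBE : measurable_fun setT (fun z => (B z)%:E) by exact/measurable_EFinP.
under eq_integral do rewrite mulrDr EFinD.
rewrite ge0_integralD//; try by move=> z _; rewrite lee_fin mulr_ge0.
rewrite ge0_muleDr ?integral_ge0//; try by move=> z _; rewrite lee_fin.
congr (_ + _).
- rewrite fubini_tonelli1//; last by move=> z; rewrite lee_fin mulr_ge0.
  rewrite -ge0_integralZl//; last 2 first.
  + by move=> z _; rewrite lee_fin.
  + by apply: integral_ge0 => z _; rewrite lee_fin.
  apply: eq_integral => x _; rewrite /fubini_F /=.
  under eq_integral do rewrite EFinM.
  rewrite ge0_integralZr//; last 3 first.
  + by apply/measurable_EFinP; exact: (measurableT_comp mpsi2 (pair1_measurable x)).
  + by move=> y _; rewrite lee_fin.
  + by rewrite lee_fin.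
  by rewrite (integral_lebesgueRd_vsub x (F := fun z => (psi z)%:E)).
- rewrite fubini_tonelli2//; last by move=> z; rewrite lee_fin mulr_ge0.
  rewrite -ge0_integralZl//; last 2 first.
  + by move=> z _; rewrite lee_fin.
  + by apply: integral_ge0 => z _; rewrite lee_fin.
  apply: eq_integral => y _; rewrite /fubini_G /=.
  under eq_integral do rewrite EFinM.
  rewrite ge0_integralZr//; last 3 first.
  + by apply/measurable_EFinP; exact: (measurableT_comp mpsi2 (pair2_measurable y)).
  + by move=> x _; rewrite lee_fin.
  + by rewrite lee_fin.
  by rewrite (integral_lebesgueRd_vsub_swap y (F := fun z => (psi z)%:E)).
Qed.

(** The measure of [N] is computed in the coordinates [(x, z)] with [y = x + z],
    integrating over [x] first; this suits sets described through the increment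
    [z], as functions of [z] are then constants of the inner integral. *)
Lemma null_shear (N : set (T * T)) : measurable N ->
  (forall z, lambda [set x | N (x, vadd x z)] = 0) ->
  (lambda \x lambda) N = 0.
Proof.
move=> mN N0.
have mI : measurable_fun setT (fun w : T * T => (\1_N w)%:E : \bar R).
  by apply/measurable_EFinP; exact: measurable_indic.
have -> : (lambda \x lambda) N = \int[lambda \x lambda]_w (\1_N w)%:E.
  by rewrite integral_indic// setIT.
rewrite fubini_tonelli1//.
have msh : measurable_fun setT (fun w : T * T => (w.1, vadd w.1 w.2)).
  by apply: measurable_fun_pair => //; exact: measurable_vadd.
have mIs : measurable_fun setT
    (fun w : T * T => (\1_N (w.1, vadd w.1 w.2))%:E : \bar R).
  exact: measurableT_comp mI msh.
transitivity (\int[lambda]_x \int[lambda]_z (\1_N (x, vadd x z))%:E : \bar R).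
  apply: eq_integral => x _; rewrite /fubini_F /=.
  rewrite -(integral_lebesgueRdD x)//.
  exact: (measurableT_comp mI (pair1_measurable x)).
rewrite -(fubini_tonelli1 (m1 := lambda) (m2 := lambda) _ mIs)// fubini_tonelli2//.
rewrite integral0_eq// => z _; rewrite /fubini_G /=.
rewrite (eq_integral (fun x => (\1_[set x | N (x, vadd x z)] x)%:E : \bar R)).
  rewrite integral_indic// ?setIT//; first exact: N0.
  have := measurableT_comp msh (pair2_measurable z).
  by move=> /(_ measurableT _ mN); rewrite setTI.
by move=> x _; congr (_%:E); exact: eq_indic.
Qed.

Lemma integral_swap (F : T * T -> \bar R) :
  measurable_fun setT F -> (forall z, 0 <= F z) ->
  \int[lambda \x lambda]_z F (swap_pair z) = \int[lambda \x lambda]_z F z.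
Proof.
move=> mF F0; rewrite fubini_tonelli2//; last first.
  exact: measurableT_comp mF (@measurable_swap _ _ _ _).
by rewrite [RHS]fubini_tonelli1.
Qed.

End integral_on_pairs.

(** * The mean squared increment of the chain is below twice the variance *)

Section measurable_if.
Context {d : measure_display} {T : measurableType d} {R : realType}.
Implicit Types f g h k : T -> R.

Lemma measurable_if_lt f g h k :
  measurable_fun setT f -> measurable_fun setT g ->
  measurable_fun setT h -> measurable_fun setT k ->
  measurable_fun setT (fun x => if f x < g x then h x else k x).
Proof.
by move=> mf mg mh mk; exact: measurable_fun_ifT (measurable_fun_ltr mf mg) mh mk.
Qed.

Lemma measurable_if_le f g h k :
  measurable_fun setT f -> measurable_fun setT g ->
  measurable_fun setT h -> measurable_fun setT k ->
  measurable_fun setT (fun x => if f x <= g x then h x else k x).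
Proof.
by move=> mf mg mh mk; exact: measurable_fun_ifT (measurable_fun_ler mf mg) mh mk.
Qed.

End measurable_if.

Section dirichlet_form.
Context {R : realType} {d : nat}.
Local Notation T := (d.-tuple R).
Local Notation lambda := (@lebesgueRd R d).
Variables (c : T) (pi phi : T -> R).
Hypothesis c0 : c <> [tuple 0 | i < d].
Hypotheses (pi_density : is_density pi) (phi_density : is_density phi).

Lemma inner_vadd (x z : T) : inner c (vadd x z) = inner c x + inner c z.
Proof.
rewrite /inner -big_split/=; apply: eq_bigr => i _.
by rewrite tnth_mktuple mulrDr.
Qed.

Lemma inner_vopp (z : T) : inner c (vopp z) = - inner c z.
Proof.
by rewrite /inner -sumrN; apply: eq_bigr => i _; rewrite tnth_mktuple mulrN.
Qed.

Lemma inner_vsub (x y : T) : inner c (vsub y x) = inner c y - inner c x.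
Proof.
by rewrite /inner -sumrB; apply: eq_bigr => i _; rewrite tnth_mktuple mulrBr.
Qed.

Let mpi : measurable_fun setT pi. Proof. by case: pi_density. Qed.
Let mphi : measurable_fun setT phi. Proof. by case: phi_density. Qed.
Let pi0 x : 0 <= pi x. Proof. by case: pi_density. Qed.
Let phi0 x : 0 <= phi x. Proof. by case: phi_density. Qed.
Let mf : measurable_fun setT (inner c). Proof. exact: measurable_inner. Qed.

(** The density of an accepted move from [z.1] to [z.2] in the stationary chain;
    its symmetry is detailed balance. *)
Definition flow (z : T * T) : R :=
  Num.min (pi z.1 * proposal phi z.1 z.2) (pi z.2 * proposal phi z.2 z.1).

Lemma measurable_proposal : measurable_fun setT (fun z : T * T => proposal phi z.1 z.2).
Proof. exact: measurableT_comp mphi (@measurable_vsub R d). Qed.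

Lemma measurable_proposal_swap :
  measurable_fun setT (fun z : T * T => proposal phi z.2 z.1).
Proof. exact: (measurableT_comp measurable_proposal (@measurable_swap _ _ _ _)). Qed.

Lemma measurable_flow : measurable_fun setT flow.
Proof.
apply: measurable_minr; apply: measurable_funM.
- exact: measurableT_comp mpi measurable_fst.
- exact: measurable_proposal.
- exact: measurableT_comp mpi measurable_snd.
- exact: measurable_proposal_swap.
Qed.

Lemma flow_ge0 z : 0 <= flow z.
Proof. by rewrite le_min; apply/andP; split; apply: mulr_ge0 => //; exact: phi0. Qed.

Lemma flow_swap z : flow (swap_pair z) = flow z.
Proof. by rewrite /flow/= minC. Qed.

(** The density of the unsigned step: a step and its opposite are merged into the
    one that increases the linear functional. *)
Definition half_step (z : T) : R :=
  if 0 < inner c z then phi z + phi (vopp z) else 0.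

Lemma measurable_half_step : measurable_fun setT half_step.
Proof.
apply: measurable_if_lt => //; try exact: measurable_cst.
by apply: measurable_funD => //; exact: measurableT_comp mphi (@measurable_vopp R d).
Qed.

Lemma half_step_ge0 z : 0 <= half_step z.
Proof. by rewrite /half_step; case: ifP => // _; rewrite addr_ge0. Qed.

(** After the reflection [z |-> - z] of the second summand, the two summands
    restrict [phi] to the disjoint half-spaces [<c, z> > 0] and [<c, z> < 0]. *)
Lemma integral_half_step_le1 : (\int[lambda]_z (half_step z)%:E <= 1)%E.
Proof.
pose up z := if 0 < inner c z then phi z else 0.
pose down z := if inner c z < 0 then phi z else 0.
have mup : measurable_fun setT up.
  by apply: measurable_if_lt => //; exact: measurable_cst.
have mdown : measurable_fun setT down.
  by apply: measurable_if_lt => //; exact: measurable_cst.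
have up0 z : 0 <= up z by rewrite /up; case: ifP.
have down0 z : 0 <= down z by rewrite /down; case: ifP.
have mupE : measurable_fun setT (fun z => (up z)%:E) by exact/measurable_EFinP.
have mdownE : measurable_fun setT (fun z => (down z)%:E) by exact/measurable_EFinP.
have -> : (\int[lambda]_z (half_step z)%:E =
    \int[lambda]_z ((up z)%:E + (down (vopp z))%:E))%E.
  apply: eq_integral => z _; rewrite -EFinD /half_step /up /down inner_vopp oppr_lt0.
  by case: ifP => //; rewrite addr0.
rewrite ge0_integralD//; last 3 first.
- by move=> z _; rewrite lee_fin.
- by move=> z _; rewrite lee_fin.
- by apply: measurableT_comp mdownE _; exact: measurable_vopp.
rewrite (integral_lebesgueRdN (F := fun z => (down z)%:E))//.
rewrite -ge0_integralD//; try by move=> z _; rewrite lee_fin.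
case: phi_density => _ _ <-; apply: ge0_le_integral => //.
- by move=> z _; rewrite adde_ge0// lee_fin.
- exact: emeasurable_funD.
- exact/measurable_EFinP.
- move=> z _; rewrite -EFinD lee_fin /up /down.
  by case: (ltgtP 0 (inner c z)) => // _; rewrite ?addr0 ?add0r.
Qed.

Definition energy (z : T * T) : R := flow z * (inner c z.2 - inner c z.1) ^+ 2.

Lemma measurable_energy : measurable_fun setT energy.
Proof.
apply: measurable_funM; first exact: measurable_flow.
apply: measurable_funX; apply: measurable_funB.
- exact: measurableT_comp mf measurable_snd.
- exact: measurableT_comp mf measurable_fst.
Qed.

Lemma energy_ge0 z : 0 <= energy z.
Proof. by rewrite mulr_ge0 ?flow_ge0 ?sqr_ge0. Qed.

Definition up_energy (z : T * T) : R :=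
  if inner c z.1 < inner c z.2 then energy z else 0.

Lemma measurable_up_energy : measurable_fun setT up_energy.
Proof.
apply: measurable_if_lt; [| |exact: measurable_energy|exact: measurable_cst].
- exact: measurableT_comp mf measurable_fst.
- exact: measurableT_comp mf measurable_snd.
Qed.

Lemma up_energy_ge0 z : 0 <= up_energy z.
Proof. by rewrite /up_energy; case: ifP => // _; exact: energy_ge0. Qed.

Lemma integral_energyE : (\int[lambda \x lambda]_z (energy z)%:E =
  \int[lambda \x lambda]_z (up_energy z)%:E +
  \int[lambda \x lambda]_z (up_energy z)%:E)%E.
Proof.
have mE : measurable_fun setT (fun z => (up_energy z)%:E).
  by apply/measurable_EFinP; exact: measurable_up_energy.
have E0 z : (0 <= (up_energy z)%:E)%E by rewrite lee_fin up_energy_ge0.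
rewrite -[X in (_ + X)%E](integral_swap mE)// -ge0_integralD//; last first.
  exact: measurableT_comp mE (@measurable_swap _ _ _ _).
apply: eq_integral => z _; rewrite -EFinD; congr _%:E.
have energyC : energy (swap_pair z) = energy z.
  by rewrite /energy flow_swap/= -sqrrN opprB.
rewrite /up_energy energyC/=.
case: ltgtP => h; rewrite ?addr0 ?add0r//.
by rewrite /energy h subrr expr0n mulr0.
Qed.

Variable mu : R.

(** The variance is split along the hyperplane [<c, x> = mu]: a move is charged to
    its lower endpoint only below that hyperplane, and to its upper endpoint only
    above it, so that no point is charged in both roles. *)
Definition low_cost (x : T) : R :=
  if inner c x - mu <= 0 then (inner c x - mu) ^+ 2 * pi x else 0.
Definition high_cost (y : T) : R :=
  if 0 < inner c y - mu then (inner c y - mu) ^+ 2 * pi y else 0.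

Let mg : measurable_fun setT (fun x => inner c x - mu).
Proof. exact: measurable_funB. Qed.

Let msq : measurable_fun setT (fun x => (inner c x - mu) ^+ 2 * pi x).
Proof. by apply: measurable_funM => //; exact: measurable_funX. Qed.

Let sq0 x : 0 <= (inner c x - mu) ^+ 2 * pi x.
Proof. by rewrite mulr_ge0 ?sqr_ge0. Qed.

Lemma measurable_low_cost : measurable_fun setT low_cost.
Proof. by apply: measurable_if_le => //; exact: measurable_cst. Qed.

Lemma measurable_high_cost : measurable_fun setT high_cost.
Proof. by apply: measurable_if_lt => //; exact: measurable_cst. Qed.

Lemma low_cost_ge0 x : 0 <= low_cost x.
Proof. by rewrite /low_cost; case: ifP. Qed.

Lemma high_cost_ge0 x : 0 <= high_cost x.
Proof. by rewrite /high_cost; case: ifP. Qed.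

Definition majorant (z : T * T) : R :=
  half_step (vsub z.2 z.1) * (low_cost z.1 + high_cost z.2).

Lemma measurable_majorant : measurable_fun setT majorant.
Proof.
apply: measurable_funM.
  exact: measurableT_comp measurable_half_step (@measurable_vsub R d).
apply: measurable_funD.
- exact: measurableT_comp measurable_low_cost measurable_fst.
- exact: measurableT_comp measurable_high_cost measurable_snd.
Qed.

Lemma majorant_ge0 z : 0 <= majorant z.
Proof. by rewrite mulr_ge0 ?half_step_ge0 ?addr_ge0 ?low_cost_ge0 ?high_cost_ge0. Qed.

(** Each cost depends on one endpoint only, so integrating out the increment leaves
    the mass of [half_step], at most [1], times the sum of the two costs, which is
    the full variance. *)
Lemma integral_majorant_le : (\int[lambda \x lambda]_z (majorant z)%:E <=
  \int[lambda]_x ((inner c x - mu) ^+ 2 * pi x)%:E)%E.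
Proof.
rewrite integral_convolution//; try solve [exact: measurable_half_step
  | exact: measurable_low_cost | exact: measurable_high_cost | exact: half_step_ge0
  | exact: low_cost_ge0 | exact: high_cost_ge0].
rewrite -ge0_integralD//;
  try (by move=> x _; rewrite lee_fin ?low_cost_ge0 ?high_cost_ge0);
  try (by apply/measurable_EFinP;
    first [exact: measurable_low_cost | exact: measurable_high_cost]).
have -> : (\int[lambda]_x ((low_cost x)%:E + (high_cost x)%:E) =
    \int[lambda]_x ((inner c x - mu) ^+ 2 * pi x)%:E)%E.
  apply: eq_integral => x _; rewrite -EFinD /low_cost /high_cost.
  by case: (leP (inner c x - mu) 0) => _; rewrite ?addr0 ?add0r.
rewrite -[leRHS]mul1e; apply: lee_wpmul2r.
  by apply: integral_ge0 => x _; rewrite lee_fin.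
exact: integral_half_step_le1.
Qed.

Lemma up_energy_le_majorant z : up_energy z <= majorant z.
Proof.
rewrite /up_energy; case: ifP => [lt12|_]; last exact: majorant_ge0.
rewrite /majorant /half_step inner_vsub subr_gt0 lt12 vopp_vsub.
have lt12' : inner c z.1 - mu < inner c z.2 - mu by rewrite ltrD2r.
have [+ _] := min_flow_sqr_le (pi0 z.1) (pi0 z.2) (phi0 (vsub z.2 z.1))
  (phi0 (vsub z.1 z.2)) lt12'.
by rewrite /energy opprB addrA subrK.
Qed.

Lemma up_energy_eq_majorant z : up_energy z = majorant z ->
  inner c z.1 <> mu -> inner c z.2 <> mu ->
  (phi (vsub z.2 z.1) + phi (vsub z.1 z.2) <> 0 ->
   (inner c z.1 - mu) * phi (vsub z.1 z.2) +
   (inner c z.2 - mu) * phi (vsub z.2 z.1) <> 0) -> majorant z = 0.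
Proof.
rewrite /up_energy; case: ifP => [lt12|_ <-//].
rewrite /majorant /half_step inner_vsub subr_gt0 lt12 vopp_vsub.
have lt12' : inner c z.1 - mu < inner c z.2 - mu by rewrite ltrD2r.
have [_ +] := min_flow_sqr_le (pi0 z.1) (pi0 z.2) (phi0 (vsub z.2 z.1))
  (phi0 (vsub z.1 z.2)) lt12'.
rewrite /energy opprB addrA subrK => h e n1 n2 n3; apply: h => //; lra.
Qed.

(** The pairs at which the Cauchy-Schwarz step of the pointwise bound is an
    equality. *)
Definition degenerate : set (T * T) := [set z |
  phi (vsub z.2 z.1) + phi (vsub z.1 z.2) <> 0 /\
  (inner c z.1 - mu) * phi (vsub z.1 z.2) +
  (inner c z.2 - mu) * phi (vsub z.2 z.1) = 0].

Lemma measurable_degenerate : measurable degenerate.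
Proof.
pose h1 (z : T * T) := phi (vsub z.2 z.1) + phi (vsub z.1 z.2).
pose h2 (z : T * T) := (inner c z.1 - mu) * phi (vsub z.1 z.2) +
  (inner c z.2 - mu) * phi (vsub z.2 z.1).
have -> : degenerate = (h1 @^-1` ~` [set 0]) `&` (h2 @^-1` [set 0]) by [].
have mh1 : measurable_fun setT h1.
  apply: measurable_funD; [exact: measurable_proposal|].
  exact: measurable_proposal_swap.
have mh2 : measurable_fun setT h2.
  apply: measurable_funD; apply: measurable_funM.
  - exact: measurableT_comp mg measurable_fst.
  - exact: measurable_proposal_swap.
  - exact: measurableT_comp mg measurable_snd.
  - exact: measurable_proposal.
apply: measurableI; rewrite -[X in measurable X]setTI.
- by apply: mh1 => //; exact: measurableC.
- exact: mh2.
Qed.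

(** For a fixed increment [z] the defining equation is affine in [x] along [c],
    with leading coefficient [phi z + phi (- z) <> 0]. *)
Lemma degenerate_null : (lambda \x lambda)%E degenerate = 0%E.
Proof.
apply: null_shear => [|z]; first exact: measurable_degenerate.
have [s0|/eqP s0] := eqVneq (phi z + phi (vopp z)) 0.
  rewrite (_ : mkset _ = set0) ?measure0//; apply/seteqP; split => // x [/= + _].
  by rewrite -(vopp_vsub x) vsub_vadd.
rewrite -[RHS](hyperplane_null
  (mu - inner c z * phi z / (phi z + phi (vopp z))) c0).
congr (_ _); apply/seteqP; split => x /=;
  rewrite /degenerate/= -(vopp_vsub x) vsub_vadd inner_vadd.
  move=> [_ e]; apply/eqP; rewrite -subr_eq0; apply/eqP.
  apply: (mulIf (introN eqP s0)); rewrite mul0r -[RHS]e; field; exact/eqP.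
by move=> ->; split => //; field; exact/eqP.
Qed.

(** [P] is one of the two endpoints of a move: at a fixed increment [z] its value
    of the functional differs from that at [x] by the constant [s z]. *)
Lemma ae_neq_inner (k : R) (P : T * T -> T) (s : T -> R) :
  measurable_fun setT P ->
  (forall x z, inner c (P (x, vadd x z)) = inner c x + s z) ->
  {ae (lambda \x lambda)%E, forall z, inner c (P z) <> k}.
Proof.
move=> mP Ps.
have mN : measurable [set z | inner c (P z) = k].
  have := measurableT_comp mf mP measurableT (measurable_set1 k).
  by rewrite setTI.
apply: (ae_notin mN); apply: null_shear => // z.
rewrite -[RHS](hyperplane_null (k - s z) c0).
congr (_ _); apply/seteqP; split => x /=; rewrite Ps.
- by move=> <-; rewrite addrK.
- by move=> ->; rewrite subrK.
Qed.

(** If the bound were attained, [up_energy] and [majorant] would agree almost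
    everywhere, hence vanish almost everywhere by the equality case, hence [V = 0];
    then [pi] would be concentrated on a hyperplane, a null set. *)
Lemma energy_lt :
  let V := (\int[lambda]_x ((inner c x - mu) ^+ 2 * pi x)%:E)%E in
  (V < +oo)%E -> (\int[lambda \x lambda]_z (energy z)%:E < V + V)%E.
Proof.
move=> V Voo.
have mrE : measurable_fun setT (fun z => (majorant z)%:E).
  by apply/measurable_EFinP; exact: measurable_majorant.
have mlE : measurable_fun setT (fun z => (up_energy z)%:E).
  by apply/measurable_EFinP; exact: measurable_up_energy.
have lr : (\int[lambda \x lambda]_z (up_energy z)%:E <=
           \int[lambda \x lambda]_z (majorant z)%:E)%E.
  apply: ge0_le_integral => // z _; rewrite lee_fin.
  - exact: up_energy_ge0.
  - exact: up_energy_le_majorant.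
suff lt : (\int[lambda \x lambda]_z (up_energy z)%:E < V)%E.
  by rewrite integral_energyE; exact: lteD.
rewrite ltNge; apply/negP => Vl.
have lE : {ae (lambda \x lambda)%E, forall z, (up_energy z)%:E = (majorant z)%:E}.
  apply: (ge0_le_integral_ae_eq mlE mrE) => //.
  - by move=> z; rewrite lee_fin up_energy_ge0.
  - by move=> z; rewrite lee_fin up_energy_le_majorant.
  - exact: le_trans integral_majorant_le Vl.
  - exact: le_lt_trans integral_majorant_le Voo.
have r0 : {ae (lambda \x lambda)%E, forall z, (majorant z)%:E = 0%E}.
  have n1 : {ae (lambda \x lambda)%E, forall z, inner c z.1 <> mu}.
    by apply: (@ae_neq_inner mu fst (fun=> 0)) => // x z /=; rewrite addr0.
  have n2 : {ae (lambda \x lambda)%E, forall z, inner c z.2 <> mu}.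
    by apply: (@ae_neq_inner mu snd (inner c)) => // x z /=; exact: inner_vadd.
  have n3 := ae_notin measurable_degenerate degenerate_null.
  apply: filterS2 (filterI n1 n2) (filterI n3 lE) => z [m1 m2] [m3 [e]].
  congr _%:E; apply: (up_energy_eq_majorant e m1 m2) => p0 q0.
  by apply: m3.
have V0 : V = 0%E.
  apply/eqP; rewrite eq_le integral_ge0 ?andbT; last by move=> x _; rewrite lee_fin.
  apply: (le_trans Vl); apply: (le_trans lr).
  rewrite (ae_eq_integral (cst 0%E))//; first by rewrite integral0.
  by apply: filterS r0 => z -> _.
have mV : measurable_fun setT (fun x => ((inner c x - mu) ^+ 2 * pi x)%:E).
  exact/measurable_EFinP.
have /(ae_eq_integral_abs _ measurableT mV) Vae :
    (\int[lambda]_x `| ((inner c x - mu) ^+ 2 * pi x)%:E | = 0)%E.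
  by rewrite -V0; apply: eq_integral => x _; rewrite gee0_abs// lee_fin.
have Hae := ae_notin (measurable_hyperplane c mu) (hyperplane_null mu c0).
have [_ _ pi1] := pi_density.
have : (\int[lambda]_x (pi x)%:E = 0)%E.
  rewrite (ae_eq_integral (cst 0%E))//; first by rewrite integral0.
    exact/measurable_EFinP.
  apply: filterS2 Vae Hae => x /(_ I) /= [] /eqP.
  rewrite mulf_eq0 sqrf_eq0 subr_eq0 => /orP[/eqP e /(_ e)//|/eqP -> _ _//].
by rewrite pi1 => /eqP; rewrite onee_eq0.
Qed.

End dirichlet_form.

(** * Measures with a density *)

Section density_measure.
Context {d : measure_display} {T : measurableType d} {R : realType}.
Variables (mu : {measure set T -> \bar R}) (w : T -> R).
Hypotheses (mw : measurable_fun setT w) (w0 : forall x, 0 <= w x).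
Local Open Scope ereal_scope.

(** The two side conditions are arguments so that the measure structure can be
    attached to the definition. *)
Definition density_measure of measurable_fun setT w & (forall x, 0 <= w x)%R :=
  fun A : set T => \int[mu]_(x in A) (w x)%:E.

Local Notation nu := (density_measure mw w0).

Let nu0 : nu set0 = 0.
Proof. by rewrite /density_measure integral_set0. Qed.

Let nu_ge0 A : 0 <= nu A.
Proof. by apply: integral_ge0 => x _; rewrite lee_fin. Qed.

Let nu_sigma_additive : semi_sigma_additive nu.
Proof.
move=> A mA tA mUA; rewrite /density_measure ge0_integral_bigcup//; last 2 first.
- by apply: measurable_funTS; exact/measurable_EFinP.
- by move=> x _; rewrite lee_fin.
by apply: is_cvg_ereal_nneg_natsum_cond => n _ _; exact: nu_ge0.
Qed.

HB.instance Definition _ := isMeasure.Build _ _ _ nu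
  nu0 nu_ge0 nu_sigma_additive.

Import HBNNSimple.

Lemma density_measureE A : measurable A ->
  nu A = \int[mu]_x (w x * \1_A x)%:E.
Proof.
move=> mA; rewrite /density_measure integral_mkcond; apply: eq_integral => x _.
by rewrite patchE indicE; case: ifP => _; rewrite ?mulr1 ?mulr0.
Qed.

(** True for indicators by definition, hence for simple functions, and in general
    by monotone convergence on both sides. *)
Lemma ge0_integral_density (f : T -> \bar R) :
  measurable_fun setT f -> (forall x, 0 <= f x) ->
  \int[nu]_x f x = \int[mu]_x ((w x)%:E * f x).
Proof.
move=> mf f0; pose f_ := nnsfun_approx measurableT mf.
have f_f x : (f_ n x)%:E @[n --> \oo] --> f x.
  by apply: cvg_nnsfun_approx => // y _; exact: f0.
have mwE : measurable_fun setT (fun x => (w x)%:E) by exact/measurable_EFinP.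
have mf_ n : measurable_fun setT (fun x => (f_ n x)%:E) by exact/measurable_EFinP.
transitivity (limn (fun n => \int[nu]_x (f_ n x)%:E)).
  rewrite -monotone_convergence//.
  - by apply: eq_integral => y _; apply/esym/cvg_lim => //; exact: f_f.
  - by move=> n y _; rewrite lee_fin.
  - by move=> y _ m n mn; rewrite lee_fin; exact/lefP/nd_nnsfun_approx.
transitivity (limn (fun n => \int[mu]_x ((w x)%:E * (f_ n x)%:E))); last first.
  rewrite -monotone_convergence//.
  - apply: eq_integral => y _; apply/cvg_lim => //.
    by apply: cvgeZl => //; exact: f_f.
  - by move=> n; exact: emeasurable_funM.
  - by move=> n y _; rewrite mule_ge0// lee_fin.
  - move=> y _ m n mn; apply: lee_wpmul2l; rewrite lee_fin//.
    exact/lefP/nd_nnsfun_approx.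
apply/congr_lim/funext => n.
rewrite integralT_nnsfun sintegralE.
transitivity (\int[mu]_x \sum_(k \in range (f_ n))
    (w x * (k * \1_(f_ n @^-1` [set k]) x))%:E).
  rewrite ge0_integral_fsum//; last 2 first.
  - move=> k; apply/measurable_EFinP; apply: measurable_funM => //.
    exact: measurable_funM.
  - move=> k x _; rewrite lee_fin mulr_ge0//.
    by have := nnfun_muleindic_ge0 (f_ n) k x; rewrite lee_fin.
  apply: eq_fsbigr => k _.
  transitivity (k%:E * \int[mu]_x (w x * \1_(f_ n @^-1` [set k]) x)%:E).
    by congr (_ * _); exact: density_measureE.
  have [k0|k0] := leP 0%R k; last first.
    rewrite preimage_nnfun0// [in RHS]integral0_eq => [|x _]; last first.
      by rewrite indicE in_set0 !mulr0.
    by rewrite integral0_eq ?mule0// => x _; rewrite indicE in_set0 mulr0.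
  rewrite -ge0_integralZl//.
  - by apply: eq_integral => x _; rewrite -EFinM mulrCA.
  - by apply/measurable_EFinP; exact: measurable_funM.
  - by move=> x _; rewrite lee_fin mulr_ge0.
apply: eq_integral => x _; rewrite -EFinM [in RHS]fimfunE mulr_fsumr.
by rewrite -fsumEFin.
Qed.

End density_measure.

(** * The law of two consecutive states *)

(** On nonnegative reals the inverse is the power of exponent [- 1], which is
    measurable; at [0] both are [0]. *)
Lemma measurable_fun_inv_ge0 {d : measure_display} {T : measurableType d}
    {R : realType} (f : T -> R) :
  measurable_fun setT f -> (forall x, 0 <= f x) ->
  measurable_fun setT (fun x => (f x)^-1).
Proof.
move=> mf f0; rewrite (_ : (fun x => _) = (fun x => f x `^ (-1))).
  exact: (measurableT_comp (measurable_powR (-1)) mf).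
by apply/funext => x; rewrite powR_inv1.
Qed.

Lemma indic_setX {T1 T2 : Type} {R : realType} (A : set T1) (B : set T2) z :
  \1_(A `*` B) z = \1_A z.1 * \1_B z.2 :> R.
Proof. by rewrite !indicE in_setX -natrM mulnb. Qed.

Lemma pushforward_is_measure d1 d2 (T1 : measurableType d1) (T2 : measurableType d2)
    (R : realType) (m : {measure set T1 -> \bar R}) (f : T1 -> T2) :
  measurable_fun setT f ->
  exists nu : {measure set T2 -> \bar R}, nu = pushforward m f :> (set T2 -> \bar R).
Proof. by move=> mf; unshelve eexists (pushforward m f). Qed.

Section transition.
Context {R : realType} {d : nat}.
Local Notation T := (d.-tuple R).
Local Notation lambda := (@lebesgueRd R d).
Variables (pi phi : T -> R).
Hypotheses (pi_density : is_density pi) (phi_density : is_density phi).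

Let mpi : measurable_fun setT pi. Proof. by case: pi_density. Qed.
Let pi0 x : 0 <= pi x. Proof. by case: pi_density. Qed.
Let phi0 x : 0 <= phi x. Proof. by case: phi_density. Qed.
Let prop0 x y : 0 <= proposal phi x y. Proof. exact: phi0. Qed.
Let mflow : measurable_fun setT (flow pi phi). Proof. exact: measurable_flow. Qed.
Let mprop : measurable_fun setT (fun z : T * T => proposal phi z.1 z.2).
Proof. exact: measurable_proposal. Qed.
Let mprop' : measurable_fun setT (fun z : T * T => proposal phi z.2 z.1).
Proof. exact: measurable_proposal_swap. Qed.
Let mpi1 : measurable_fun setT (fun z : T * T => pi z.1).
Proof. exact: measurableT_comp mpi measurable_fst. Qed.
Let mpi2 : measurable_fun setT (fun z : T * T => pi z.2).
Proof. exact: measurableT_comp mpi measurable_snd. Qed.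

Lemma acceptance_ge0 x y : 0 <= acceptance pi phi x y.
Proof.
rewrite /acceptance; case: ifP => // _; rewrite le_min ler01/=.
by rewrite divr_ge0// mulr_ge0.
Qed.

Lemma acceptance_le1 x y : acceptance pi phi x y <= 1.
Proof. by rewrite /acceptance; case: ifP => // _; rewrite ge_min lexx. Qed.

Lemma measurable_acceptance :
  measurable_fun setT (fun z : T * T => acceptance pi phi z.1 z.2).
Proof.
have mf : measurable_fun setT (fun z : T * T => pi z.1 * proposal phi z.1 z.2).
  exact: measurable_funM.
apply: measurable_if_lt => //; try exact: measurable_cst.
apply: measurable_minr; first exact: measurable_cst.
apply: measurable_funM; first exact: measurable_funM.
by apply: measurable_fun_inv_ge0 => // z; rewrite mulr_ge0.
Qed.

(** The acceptance probability of Metropolis and Hastings is the one that turns the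
    proposal flow into its minimum with the reverse proposal flow. *)
Lemma flow_acceptance x y :
  pi x * proposal phi x y * acceptance pi phi x y = flow pi phi (x, y).
Proof.
rewrite /acceptance /flow/=; case: ltP => [a0|a0].
  rewrite minr_pMr ?ltW// mulr1; congr Num.min.
  by rewrite mulrCA divff ?gt_eqF// mulr1.
have -> : pi x * proposal phi x y = 0.
  by apply/eqP; rewrite eq_le a0 mulr_ge0.
by rewrite mul0r; apply/esym/min_idPl; rewrite mulr_ge0.
Qed.

(** The density of proposing [z.2] from [z.1] in the stationary chain and
    rejecting the proposal. *)
Definition reject (z : T * T) : R := pi z.1 * proposal phi z.1 z.2 - flow pi phi z.

Lemma measurable_reject : measurable_fun setT reject.
Proof. by apply: measurable_funB => //; exact: measurable_funM. Qed.

Lemma reject_ge0 z : 0 <= reject z.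
Proof. by rewrite subr_ge0 ge_min lexx. Qed.

Definition step_integrand (B : set T) (z : T * T) : R :=
  proposal phi z.1 z.2 * (acceptance pi phi z.1 z.2 * \1_B z.2 +
    (1 - acceptance pi phi z.1 z.2) * \1_B z.1).

Lemma measurable_step_integrand B : measurable B ->
  measurable_fun setT (step_integrand B).
Proof.
move=> mB; apply: measurable_funM => //.
have macc := measurable_acceptance.
have mB1 : measurable_fun setT (fun z : T * T => \1_B z.1 : R).
  by apply: (measurableT_comp _ measurable_fst); exact: measurable_indic.
have mB2 : measurable_fun setT (fun z : T * T => \1_B z.2 : R).
  by apply: (measurableT_comp _ measurable_snd); exact: measurable_indic.
apply: measurable_funD; apply: measurable_funM => //.
by apply: measurable_funB => //; exact: measurable_cst.
Qed.

Lemma step_integrand_ge0 B z : 0 <= step_integrand B z.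
Proof.
rewrite mulr_ge0// addr_ge0// mulr_ge0 ?acceptance_ge0//.
by rewrite subr_ge0 acceptance_le1.
Qed.

Local Open Scope ereal_scope.

Let mdiag : measurable_fun setT (fun z : T * T => (z.1, z.1)).
Proof. by apply: measurable_fun_pair; exact: measurable_fst. Qed.

Let flow0 z : (0 <= flow pi phi z)%R.
Proof. exact: flow_ge0. Qed.

Lemma measurable_rwmh_kernel (B : set T) : measurable B ->
  measurable_fun setT (fun x => rwmh_kernel pi phi x B).
Proof.
move=> mB.
have mIE : measurable_fun setT (fun z => (step_integrand B z)%:E).
  by apply/measurable_EFinP; exact: measurable_step_integrand.
have := @measurable_fun_fubini_tonelli_F _ _ _ _ _ lambda _ mIE.
by apply => z; rewrite lee_fin step_integrand_ge0.
Qed.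

Lemma rwmh_kernel_ge0 (x : T) (B : set T) : 0 <= rwmh_kernel pi phi x B.
Proof.
by apply: integral_ge0 => y _; rewrite lee_fin (step_integrand_ge0 B (x, y)).
Qed.

Lemma integral_rwmh_kernel (A B : set T) : measurable A -> measurable B ->
  \int[density_measure lambda mpi pi0]_(x in A) rwmh_kernel pi phi x B =
  \int[lambda \x lambda]_z
    (flow pi phi z * \1_(A `*` B) z + reject z * \1_(A `*` B) (z.1, z.1))%:E.
Proof.
move=> mA mB.
have mIE : measurable_fun setT (fun z => (step_integrand B z)%:E).
  by apply/measurable_EFinP; exact: measurable_step_integrand.
have mK := measurable_rwmh_kernel mB.
have K0 x := rwmh_kernel_ge0 x B.
have mA1 : measurable_fun setT (fun x : T => (\1_A x)%:E : \bar R).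
  by apply/measurable_EFinP; exact: measurable_indic.
transitivity (\int[density_measure lambda mpi pi0]_x
    (rwmh_kernel pi phi x B * (\1_A x)%:E)).
  rewrite integral_mkcond; apply: eq_integral => x _.
  by rewrite patchE indicE; case: ifP => _; rewrite ?mule1 ?mule0.
rewrite ge0_integral_density//; last 2 first.
- exact: emeasurable_funM.
- by move=> x; rewrite mule_ge0// lee_fin.
transitivity (\int[lambda]_x \int[lambda]_y
    ((pi x * \1_A x) * step_integrand B (x, y))%:E).
  apply: eq_integral => x _.
  under [RHS]eq_integral do rewrite EFinM.
  rewrite ge0_integralZl//.
  - by rewrite EFinM muleA muleAC.
  - exact: (measurableT_comp mIE (pair1_measurable x)).
  - by move=> y _; rewrite lee_fin step_integrand_ge0.
  - by rewrite lee_fin mulr_ge0.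
rewrite [RHS]fubini_tonelli1.
- apply: eq_integral => x _; apply: eq_integral => y _; congr _%:E.
  rewrite /step_integrand/= !indic_setX/= /reject/= -flow_acceptance; ring.
- apply/measurable_EFinP; apply: measurable_funD; apply: measurable_funM => //.
  + by apply: measurable_indic; exact: measurableX.
  + exact: measurable_reject.
  + have mIAB := @measurable_indic _ _ R setT _ (measurableX mA mB).
    exact: (measurableT_comp mIAB mdiag).
- by move=> z; rewrite lee_fin addr_ge0// mulr_ge0// ?flow_ge0// reject_ge0.
Qed.

Context {dO : measure_display} {Omega : measurableType dO}.
Variables (P : probability Omega R) (X : nat -> {RV P >-> T}).
Hypothesis chainX : stationary_rwmh pi phi X.

Lemma ge0_integral_initial (h : T -> \bar R) :
  measurable_fun setT h -> (forall x, 0 <= h x) ->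
  \int[P]_w h (X 0%N w) = \int[lambda]_x ((pi x)%:E * h x).
Proof.
move=> mh h0; rewrite -(ge0_integral_density lambda mpi pi0)//.
have := ge0_integral_distribution (X 0%N) mh h0; rewrite /comp => <-.
by apply: eq_measure_integral => A mA _; case: chainX => _; exact.
Qed.

Lemma prob_two_steps (A B : set T) : measurable A -> measurable B ->
  P (X 0%N @^-1` A `&` X 1%N @^-1` B) =
  \int[density_measure lambda mpi pi0]_(x in A) rwmh_kernel pi phi x B.
Proof.
move=> mA mB; case: chainX => markov X0pi.
rewrite (markov 0%N); last 2 first.
- rewrite /g_sigma_preimage; apply: sub_sigma_algebra.
  by rewrite big_ord_recl big_ord0 setU0; exists A => //; rewrite setTI.
- exact: mB.
have mK := measurable_rwmh_kernel mB.
have K0 x := rwmh_kernel_ge0 x B.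
transitivity (\int[distribution P (X 0%N)]_(x in A) rwmh_kernel pi phi x B).
  rewrite /distribution ge0_integral_pushforward//.
  exact: measurable_funTS.
by apply: eq_measure_integral => C mC _; exact: X0pi.
Qed.

(** The law of two consecutive states is the sum of the law of the accepted moves
    and of the law of the rejected proposals, the latter carried by the diagonal.
    The two descriptions are finite measures that agree on rectangles by the Markov
    property, hence on all measurable sets. *)
Lemma ge0_integral_two_steps (h : T * T -> \bar R) :
  measurable_fun setT h -> (forall z, 0 <= h z) ->
  \int[P]_w h (X 0%N w, X 1%N w) =
  \int[lambda \x lambda]_z ((flow pi phi z)%:E * h z) +
  \int[lambda \x lambda]_z ((reject z)%:E * h (z.1, z.1)).
Proof.
move=> mh h0.
pose moved := density_measure (lambda \x lambda) mflow flow0.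
pose diag := fun z : T * T => (z.1, z.1).
pose XX := fun w => (X 0%N w, X 1%N w).
have mXX : measurable_fun setT XX.
  by apply: measurable_fun_pair; exact: measurable_funP.
have [law lawE] := pushforward_is_measure P mXX.
have [still stillE] := pushforward_is_measure
  (density_measure (lambda \x lambda) measurable_reject reject_ge0) mdiag.
transitivity (\int[law]_z h z); first by rewrite lawE ge0_integral_pushforward.
transitivity (\int[measure_add moved still]_z h z); last first.
  rewrite ge0_integral_measure_add// stillE ge0_integral_pushforward//.
  rewrite !ge0_integral_density//; last by move=> z; exact: h0.
  exact: (measurableT_comp mh mdiag).
pose G : set (set (T * T)) :=
  [set C | exists A, measurable A /\ exists B, measurable B /\ C = A `*` B].
apply: eq_measure_integral => S mS _.
apply: (measure_unique G (fun=> setT)) => //.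
- rewrite measurable_prod_measurableType; congr (<<s _ >>).
  rewrite predeqE => C; split => [[A mA [B mB <-]]|[A [mA [B [mB ->]]]]].
    by exists A; split => //; exists B.
  by exists A => //; exists B.
- move=> _ _ [A1 [mA1 [B1 [mB1 ->]]]] [A2 [mA2 [B2 [mB2 ->]]]].
  rewrite -setXI; exists (A1 `&` A2); split; first exact: measurableI.
  by exists (B1 `&` B2); split => //; exact: measurableI.
- by move=> _; exists setT; split => //; exists setT; split => //; rewrite setXTT.
- by rewrite bigcup_const//; exists 0%N.
- move=> _ [A [mA [B [mB ->]]]].
  have mAB : measurable (A `*` B) := measurableX mA mB.
  transitivity (P (X 0%N @^-1` A `&` X 1%N @^-1` B)); first by rewrite lawE.
  rewrite prob_two_steps// integral_rwmh_kernel//.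
  have mdAB : measurable (diag @^-1` (A `*` B)).
    by rewrite -[X in measurable X]setTI; exact: mdiag.
  rewrite [RHS](_ : _ =
      \int[lambda \x lambda]_z (flow pi phi z * \1_(A `*` B) z)%:E +
      \int[lambda \x lambda]_z (reject z * \1_(diag @^-1` (A `*` B)) z)%:E);
    last first.
    transitivity (moved (A `*` B) + still (A `*` B)); first exact: measure_addE.
    by rewrite stillE; congr (_ + _); exact: density_measureE.
  have mI1 := @measurable_indic _ _ R setT _ mAB.
  have mI2 := @measurable_indic _ _ R setT _ mdAB.
  rewrite -ge0_integralD//.
  + by move=> z _; rewrite lee_fin mulr_ge0.
  + by apply/measurable_EFinP; exact: measurable_funM.
  + by move=> z _; rewrite lee_fin mulr_ge0// reject_ge0.
  + apply/measurable_EFinP; apply: measurable_funM => //.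
    exact: measurable_reject.
- move=> _; apply: (@le_lt_trans _ _ (P setT)); first by rewrite lawE.
  by rewrite probability_setT ltry.
Qed.

End transition.

(** * Stationarity and the covariance *)

Section stationarity.
Context {R : realType} {d : nat}.
Local Notation T := (d.-tuple R).
Local Notation lambda := (@lebesgueRd R d).
Variables (c : T) (pi phi : T -> R).
Hypotheses (pi_density : is_density pi) (phi_density : is_density phi).
Context {dO : measure_display} {Omega : measurableType dO}.
Variables (P : probability Omega R) (X : nat -> {RV P >-> T}).
Hypothesis chainX : stationary_rwmh pi phi X.
Local Open Scope ereal_scope.

(** Both sides are the sum of an integral against [flow] and one against [reject];
    the latter sees the two states at the same point, and the former is unchanged
    when the two states are exchanged, by the symmetry of [flow]. *)
Lemma ge0_integral_stationary (h : T -> \bar R) :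
  measurable_fun setT h -> (forall x, 0 <= h x) ->
  \int[P]_w h (X 1%N w) = \int[P]_w h (X 0%N w).
Proof.
move=> mh h0.
have mh1 : measurable_fun setT (fun z : T * T => h z.1).
  exact: measurableT_comp mh measurable_fst.
have mh2 : measurable_fun setT (fun z : T * T => h z.2).
  exact: measurableT_comp mh measurable_snd.
have mflow : measurable_fun setT (fun z => (flow pi phi z)%:E).
  by apply/measurable_EFinP; exact: measurable_flow.
have := ge0_integral_two_steps pi_density phi_density chainX mh2 (fun z => h0 z.2).
have := ge0_integral_two_steps pi_density phi_density chainX mh1 (fun z => h0 z.1).
move=> /= -> ->; congr (_ + _).
rewrite -integral_swap.
- by apply: eq_integral => z _; rewrite flow_swap.
- exact: emeasurable_funM.
- by move=> z; rewrite mule_ge0// lee_fin flow_ge0.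
Qed.

Lemma integral_stationary (h : T -> \bar R) : measurable_fun setT h ->
  \int[P]_w h (X 1%N w) = \int[P]_w h (X 0%N w).
Proof.
move=> mh; rewrite integralE [RHS]integralE.
rewrite !(funepos_comp h (X _)) !(funeneg_comp h (X _)); congr (_ - _).
- have := @ge0_integral_stationary h^\+ (measurable_funepos mh).
  by apply => x; exact: funepos_ge0.
- have := @ge0_integral_stationary h^\- (measurable_funeneg mh).
  by apply => x; exact: funeneg_ge0.
Qed.

(** Rejected proposals do not move, so only the accepted moves contribute. *)
Lemma integral_sqr_increment :
  \int[P]_w ((inner c (X 1%N w) - inner c (X 0%N w)) ^+ 2)%:E =
  \int[lambda \x lambda]_z (energy c pi phi z)%:E.
Proof.
pose h (z : T * T) := ((inner c z.2 - inner c z.1) ^+ 2)%:E.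
have mh : measurable_fun setT h.
  apply/measurable_EFinP; apply: measurable_funX; apply: measurable_funB.
  - exact: measurableT_comp (measurable_inner c) measurable_snd.
  - exact: measurableT_comp (measurable_inner c) measurable_fst.
have h0 z : 0 <= h z by rewrite lee_fin sqr_ge0.
have -> := ge0_integral_two_steps pi_density phi_density chainX mh h0.
rewrite [X in _ + X]integral0_eq ?adde0.
  by apply: eq_integral => z _; rewrite -EFinM.
by move=> z _; rewrite /h subrr expr0n mule0.
Qed.

End stationarity.

Lemma inner_ge0 {R : realType} {d : nat} (x : d.-tuple R) : 0 <= inner x x.
Proof. by apply: sumr_ge0 => i _; rewrite -expr2 sqr_ge0. Qed.

Lemma enorm_sqr {R : realType} {d : nat} (x : d.-tuple R) : enorm x ^+ 2 = inner x x.
Proof. by rewrite sqr_sqrtr// inner_ge0. Qed.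

(** By Lagrange's identity, twice the difference of the two sides is the sum over
    [i] and [j] of [(c_i x_j - c_j x_i)^2]. *)
Lemma inner_CauchySchwarz {R : realType} {d : nat} (c x : d.-tuple R) :
  inner c x ^+ 2 <= inner c c * inner x x.
Proof.
have lagrange : \sum_(i < d) \sum_(j < d)
    (tnth c i * tnth x j - tnth c j * tnth x i) ^+ 2 =
    inner c c * inner x x + inner x x * inner c c -
    (inner c x * inner c x + inner c x * inner c x).
  rewrite /inner !big_distrlr/= -!big_split/= -sumrB; apply: eq_bigr => i _.
  rewrite -!big_split/= -sumrB; apply: eq_bigr => j _; ring.
have : 0 <= \sum_(i < d) \sum_(j < d)
    (tnth c i * tnth x j - tnth c j * tnth x i) ^+ 2.
  by apply: sumr_ge0 => i _; apply: sumr_ge0 => j _; exact: sqr_ge0.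
by rewrite lagrange; nra.
Qed.

Lemma ge0_integrable_EFin {d : measure_display} {T : measurableType d}
    {R : realType} (mu : {measure set T -> \bar R}) (f : T -> R) :
  measurable_fun setT f -> (forall x, 0 <= f x) ->
  (\int[mu]_x (f x)%:E < +oo)%E -> mu.-integrable setT (EFin \o f).
Proof.
move=> mf f0 foo; apply/integrableP; split; first exact/measurable_EFinP.
by under eq_integral do rewrite /= ger0_norm//.
Qed.

Theorem corollary3p2 (R : realType) (d : nat) (c : d.-tuple R)
    (dO : measure_display) (Omega : measurableType dO)
    (P : probability Omega R)
    (pi phi : d.-tuple R -> R) (X : nat -> {RV P >-> d.-tuple R}) :
  (1 <= d)%N ->
  c <> [tuple 0 | i < d] ->
  is_density pi ->
  is_density phi ->
  stationary_rwmh pi phi X ->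
  ('E_P[(fun w => enorm (X 0%N w) ^+ 2)%R] < +oo)%E ->
  (0 < covariance P (fun w => inner c (X 0%N w)) (fun w => inner c (X 1%N w)))%E.
Proof.

move=> _ c0 dpi dphi chainX L2.
pose f (i : nat) (w : Omega) := inner c (X i w).
have mX i : measurable_fun setT (X i) by exact: measurable_funP.
have mf i : measurable_fun setT (f i).
  exact: measurableT_comp (measurable_inner c) (mX i).
pose m := fine ('E_P[f 0%N])%E.
have mE : fine ('E_P[f 1%N])%E = m.
  rewrite /m unlock; congr fine.
  apply: (integral_stationary dpi dphi chainX (h := fun x => (inner c x)%:E)).
  by apply/measurable_EFinP; exact: measurable_inner.
pose a i w := (f i w - m) ^+ 2.
pose e w := (f 1%N w - f 0%N w) ^+ 2.
have ma i : measurable_fun setT (a i).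
  by apply: measurable_funX; apply: measurable_funB => //; exact: measurable_cst.
have me : measurable_fun setT e.
  by apply: measurable_funX; exact: measurable_funB.
have a0 i w : 0 <= a i w by rewrite sqr_ge0.
have e0 w : 0 <= e w by rewrite sqr_ge0.
have msq : measurable_fun setT (fun x => ((inner c x - m) ^+ 2)%:E).
  apply/measurable_EFinP; apply: measurable_funX; apply: measurable_funB.
    exact: measurable_inner.
  exact: measurable_cst.
have sq0 x : (0 <= ((inner c x - m) ^+ 2)%:E)%E by rewrite lee_fin sqr_ge0.
set V := (\int[lebesgueRd]_x ((inner c x - m) ^+ 2 * pi x)%:E)%E.
have a0V : (\int[P]_w (a 0%N w)%:E = V)%E.
  rewrite (ge0_integral_initial dpi chainX msq sq0).
  by apply: eq_integral => x _; rewrite -EFinM mulrC.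
have a1V : (\int[P]_w (a 1%N w)%:E = V)%E.
  by rewrite -a0V; exact: (ge0_integral_stationary dpi dphi chainX msq sq0).
(* [(f - m)^2 <= 2 f^2 + 2 m^2], and [f^2] is controlled by the second moment. *)
have Voo : (V < +oo)%E.
  rewrite -a0V.
  pose K := 2 * inner c c; pose n w := enorm (X 0%N w) ^+ 2.
  have K0 : 0 <= K by rewrite mulr_ge0// inner_ge0.
  have n0 w : 0 <= n w by rewrite sqr_ge0.
  have mn : measurable_fun setT n.
    rewrite (_ : n = fun w => inner (X 0%N w) (X 0%N w)).
      apply: measurable_sum => i; apply: measurable_funM;
        exact: (measurableT_comp (@measurable_tnth _ R d i) (mX 0%N)).
    by apply/funext => w; rewrite /n enorm_sqr.
  have mnE : measurable_fun setT (fun w => (n w)%:E) by exact/measurable_EFinP.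
  apply: (@le_lt_trans _ _ (\int[P]_w (K%:E * (n w)%:E + (2 * m ^+ 2)%:E))%E).
    apply: ge0_le_integral => //.
    - by move=> w _; rewrite lee_fin.
    - exact/measurable_EFinP.
    - by apply: emeasurable_funD => //; apply: emeasurable_funM.
    move=> w _; rewrite -EFinM -EFinD lee_fin /K /n enorm_sqr.
    have cs := inner_CauchySchwarz c (X 0%N w).
    have := sqr_ge0 (f 0%N w + m); rewrite /a /f -/(f 0%N w) in cs *; nra.
  rewrite ge0_integralD//; last 3 first.
  - by move=> w _; rewrite -EFinM lee_fin mulr_ge0.
  - exact: emeasurable_funM.
  - by move=> w _; rewrite lee_fin mulr_ge0// sqr_ge0.
  have cstE : (\int[P]_w (2 * m ^+ 2)%:E = (2 * m ^+ 2)%:E)%E.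
    transitivity ((2 * m ^+ 2)%:E * P setT)%E; first exact: integral_cst.
    by rewrite probability_setT mule1.
  rewrite ge0_integralZl_EFin//; last by move=> w _; rewrite lee_fin.
  rewrite cstE.
  by move: L2; rewrite unlock => L2; rewrite lte_add_pinfty ?ltry// lte_mul_pinfty.
have eV : (\int[P]_w (e w)%:E < V + V)%E.
  rewrite (integral_sqr_increment c dpi dphi chainX).
  exact: (energy_lt c0 dpi dphi Voo).
have ia i : (i < 2)%N -> P.-integrable setT (EFin \o a i).
  by case: i => [|[|//]] _; apply: ge0_integrable_EFin => //; rewrite ?a0V ?a1V.
have ie : P.-integrable setT (EFin \o e).
  by apply: ge0_integrable_EFin => //; apply: lt_trans eV _; rewrite lte_add_pinfty.
(* Polarization: [2 (f_0 - m) (f_1 - m) = (f_0 - m)^2 + (f_1 - m)^2 - (f_1 - f_0)^2]. *)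
rewrite unlock -/(f 0%N) -/(f 1%N) mE -/m unlock.
rewrite (eq_integral (fun w => (2^-1)%:E * ((a 0%N w)%:E + (a 1%N w)%:E - (e w)%:E))%E);
  last first.
  move=> w _; rewrite -[RHS]/((2^-1 * (a 0%N w + a 1%N w - e w))%:E).
  rewrite -[LHS]/(((f 0%N w - m) * (f 1%N w - m))%:E).
  by congr _%:E; rewrite /a /e; field.
have iaa : P.-integrable setT (fun w => (a 0%N w)%:E + (a 1%N w)%:E)%E.
  by apply: integrableD => //; [exact: (ia 0%N)|exact: (ia 1%N)].
rewrite integralZl//; last by apply: integrableB.
rewrite integralB// integralD//; [|exact: (ia 0%N)|exact: (ia 1%N)].
rewrite a0V a1V mule_gt0// ?lte_fin ?invr_gt0//.
by rewrite sube_gt0.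
Qed.
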